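(* Let $G$ be a connected graph with maximum vertex degree at most $4$, let $\mathcal{T}\subseteq V(G)$ be a set of terminals such that $G$ is $\alpha$-well-linked for $\mathcal{T}$ for some $\alpha<1$, let $q$ be the smallest even integer with $q\ge4/\alpha$, and assume $|\mathcal{T}|\ge q$. Then there is an efficient algorithm that finds a partition $\mathcal{C}$ of $V(G)$ such that each set $C\in\mathcal{C}$ contains at least $q$ and at most $4q$ terminals, and each $C\in\mathcal{C}$ induces a connected subgraph of $G$.
   Context: $G$ is $\alpha$-well-linked for $\mathcal{T}$ iff for every partition $(A,B)$ of $V(G)$, $|E(A,B)|\ge\alpha\min\{|A\cap\mathcal{T}|,|B\cap\mathcal{T}|\}$. *)

(* Defs.v *)
From mathcomp Require Import all_boot all_order all_algebra.
From mathcomp Require Import reals.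

Set Implicit Arguments.
Unset Strict Implicit.
Unset Printing Implicit Defensive.

Import Order.TTheory GRing.Theory Num.Theory.

(** * Graphs *)

(* A finite loopless graph on the vertices 0, ..., nv - 1, presented by its
   list of edges.  The orientation and the position of an edge in the list are
   irrelevant.  Parallel edges (repeated entries) are allowed and are counted
   with multiplicity; simple graphs are the presentations without repetition. *)
Record graph := Graph {
  nv : nat;
  edges : seq ('I_nv * 'I_nv);
  loopless : all (fun e => e.1 != e.2) edges }.

Notation vertex G := 'I_(nv G).

Section GraphNotions.
Variable G : graph.
Implicit Types (A B T : {set vertex G}) (u v : vertex G).

Definition adj : rel (vertex G) :=
  fun u v => ((u, v) \in edges G) || ((v, u) \in edges G).

Definition degree v : nat :=
  count (fun e => (e.1 == v) || (e.2 == v)) (edges G).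

Definition max_degree_le (d : nat) : Prop := forall v, degree v <= d.

(* |E(A, B)|, for disjoint A and B. *)
Definition ncross A B : nat :=
  count (fun e => (e.1 \in A) && (e.2 \in B) || (e.1 \in B) && (e.2 \in A))
        (edges G).

Definition induces_connected A : Prop :=
  A != set0 /\
  {in A &, forall u v, connect [rel x y | [&& x \in A, y \in A & adj x y]] u v}.

Definition graph_connected : Prop := induces_connected [set: vertex G].

Definition well_linked (R : realType) (alpha : R) T : Prop :=
  forall A B, [disjoint A & B] -> A :|: B = [set: vertex G] ->
    (alpha * (minn #|A :&: T| #|B :&: T|)%:R <= (ncross A B)%:R)%R.

End GraphNotions.

(* For alpha > 0 the number 4 / alpha is positive, so that ranging over the
   natural numbers or over the integers makes no difference. *)
Definition smallest_even_ge (R : realType) (x : R) (q : nat) : Prop :=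
  [/\ ~~ odd q, (x <= q%:R)%R &
      forall r : nat, ~~ odd r -> (x <= r%:R)%R -> q <= r].

(** * Model of computation *)

(* A random access machine programmed in a while language.  Its memory is an
   array of arrays of natural numbers; a program accesses only finitely many
   of the arrays, because the array is always given by a literal, but the cell
   inside the array is computed, which provides indirect addressing.

   The only arithmetic is addition and truncated subtraction.  There is no
   multiplication, hence under the uniform cost measure below the bit length
   of the values grows at most linearly with time, and polynomial time is the
   usual (Turing machine) notion. *)
Definition memory := nat -> nat -> nat.

Inductive expr :=
  | Lit of nat
  | Cell of nat & expr
  | Plus of expr & expr
  | Minus of expr & expr.

Fixpoint eval (s : memory) (e : expr) : nat :=
  match e with
  | Lit n => n
  | Cell a e1 => s a (eval s e1)
  | Plus e1 e2 => eval s e1 + eval s e2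
  | Minus e1 e2 => eval s e1 - eval s e2
  end.

Definition update (s : memory) (a i x : nat) : memory :=
  fun b j => if (b == a) && (j == i) then x else s b j.

(* [Assign a e1 e2] stores the value of e2 in the cell of index e1 of the
   array a.  In tests, nonzero means true. *)
Inductive cmd :=
  | Skip
  | Assign of nat & expr & expr
  | Seq of cmd & cmd
  | If of expr & cmd & cmd
  | While of expr & cmd.

(* [run p s t s']: started in memory s, the program p halts after t steps in
   memory s'.  Every elementary command and every test costs one step. *)
Inductive run : cmd -> memory -> nat -> memory -> Prop :=
  | run_skip s : run Skip s 1 s
  | run_assign a e1 e2 s :
      run (Assign a e1 e2) s 1 (update s a (eval s e1) (eval s e2))
  | run_seq p1 p2 s1 s2 s3 t1 t2 :
      run p1 s1 t1 s2 -> run p2 s2 t2 s3 -> run (Seq p1 p2) s1 (t1 + t2) s3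
  | run_if_true e p1 p2 s t s' :
      eval s e != 0 -> run p1 s t s' -> run (If e p1 p2) s t.+1 s'
  | run_if_false e p1 p2 s t s' :
      eval s e = 0 -> run p2 s t s' -> run (If e p1 p2) s t.+1 s'
  | run_while_true e p s1 s2 s3 t1 t2 :
      eval s1 e != 0 -> run p s1 t1 s2 -> run (While e p) s2 t2 s3 ->
      run (While e p) s1 (t1 + t2).+1 s3
  | run_while_false e p s : eval s e = 0 -> run (While e p) s 1 s.

Lemma run_det p s t1 s1 t2 s2 :
  run p s t1 s1 -> run p s t2 s2 -> t1 = t2 /\ s1 = s2.
Proof.
move=> r1; elim: r1 t2 s2 => {p s t1 s1} *;
  match goal with r : run _ _ _ _ |- _ = ?t /\ _ = ?s =>
    match type of r with run _ _ t s => inversion r; subst; clear r end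
  end;
  repeat match goal with
  | nz : is_true (eval ?s ?e != 0), z : eval ?s ?e = 0 |- _ =>
      by rewrite z in nz
  | IH : forall t s, run ?p ?m t s -> _, r : run ?p ?m ?t ?s |- _ =>
      case: (IH t s r) => ? ?; subst; clear IH
  end; by [].
Qed.

(* The cells that are not occupied by the input contain 0. *)
Definition load (x : seq (seq nat)) : memory :=
  fun a i => nth 0 (nth [::] x a) i.

Definition input_size (x : seq (seq nat)) : nat := sumn (shape x).

(** * The computational problem *)

(* Array 0: number of vertices, number of edges, q.  Array 1: characteristic
   vector of the terminals.  Arrays 2 and 3: the endpoints of the edges. *)
Definition encode (G : graph) (T : {set vertex G}) (q : nat) : seq (seq nat) :=
  [:: [:: nv G; size (edges G); q];
      [seq nat_of_bool (v \in T) | v <- enum 'I_(nv G)];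
      [seq val e.1 | e <- edges G];
      [seq val e.2 | e <- edges G]].

(* The answer is read off array 4, which labels the vertices by the names of
   their blocks. *)
Definition outputs_partition (G : graph) (s : memory)
    (C : {set {set vertex G}}) : Prop :=
  partition C [set: vertex G] /\
  forall u v : vertex G, (s 4 u == s 4 v) = (v \in pblock C u).

(* Main.v *)
Require Import Defs.
From mathcomp Require Import all_boot all_order all_algebra.
From mathcomp Require Import reals.
From mathcomp Require Import zify.

Set Implicit Arguments.
Unset Strict Implicit.
Unset Printing Implicit Defensive.

Import Order.TTheory GRing.Theory Num.Theory.

(* In a rooted spanning tree, let every vertex that carries fewer than q
   terminals hand them to its parent, from the leaves upwards, and cut the tree
   above every vertex that carries at least q.  A vertex other than the root has
   at most three children, so such a vertex carries at most 3(q - 1) + 1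
   terminals, and the root at most 4(q - 1) + 1.  If the root ends up with fewer
   than q, its block is merged with the block of a first vertex below it, which
   gives at most (q - 1) + 3(q - 1) + 1 terminals. *)

(** * Timed total correctness for the while language *)

Section TimedExecution.
Variable N : nat.

(* An upper bound on the running time, valid as long as every execution of
   every loop makes at most N iterations. *)
Fixpoint cost (p : cmd) : nat :=
  match p with
  | Skip | Assign _ _ _ => 1
  | Seq p1 p2 => cost p1 + cost p2
  | If _ p1 p2 => (cost p1 + cost p2).+1
  | While _ p1 => (N * (cost p1).+1).+1
  end.

(** A Hoare triple for total correctness with the running time built in. The bound [cost p] is
    syntactic, so time never has to be tracked in invariants. *)
Definition does (p : cmd) (s : memory) (Q : memory -> Prop) : Prop :=
  exists t s', [/\ run p s t s', t <= cost p & Q s'].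

Lemma does_skip (s : memory) (Q : memory -> Prop) : Q s -> does Skip s Q.
Proof. by move=> Qs; exists 1, s; split=> //; apply: run_skip. Qed.

Lemma does_assign a e1 e2 (s : memory) (Q : memory -> Prop) :
  Q (update s a (eval s e1) (eval s e2)) -> does (Assign a e1 e2) s Q.
Proof. by move=> Qs; eexists; eexists; split; first exact: run_assign. Qed.

Lemma does_seq p1 p2 (s : memory) (Q : memory -> Prop) :
  does p1 s (fun s' => does p2 s' Q) -> does (Seq p1 p2) s Q.
Proof.
case=> t1 [s1 [r1 le1 [t2 [s2 [r2 le2 Qs]]]]].
exists (t1 + t2), s2; split=> //=; first exact: run_seq r1 r2.
exact: leq_add.
Qed.

Lemma does_if e p1 p2 (s : memory) (Q : memory -> Prop) :
  (eval s e != 0 -> does p1 s Q) -> (eval s e = 0 -> does p2 s Q) ->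
  does (If e p1 p2) s Q.
Proof.
move=> h1 h2; have [e0|e0] := eqVneq (eval s e) 0.
  have [t [s' [r le Qs]]] := h2 e0.
  by exists t.+1, s'; split=> //=; [exact: run_if_false | lia].
have [t [s' [r le Qs]]] := h1 e0.
by exists t.+1, s'; split=> //=; [exact: run_if_true | lia].
Qed.

(** The invariant is indexed by the number of rounds done, and [n] is the exact number of rounds.
    Termination and the time bound therefore come from [n <= N] alone. *)
Lemma does_while e p n (I : nat -> memory -> Prop) (s : memory) :
  n <= N ->
  (forall i s, i < n -> I i s -> eval s e != 0 /\ does p s (I i.+1)) ->
  (forall s, I n s -> eval s e = 0) ->
  I 0 s -> does (While e p) s (I n).
Proof.
move=> le_nN step stop I0.
suff main d : forall i s, i + d = n -> I i s ->
    exists t s', [/\ run (While e p) s t s', t <= (d * (cost p).+1).+1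
      & I n s'].
  have [t [s' [r le Is]]] := main n 0 s (add0n n) I0.
  exists t, s'; split=> //; apply: leq_trans le _.
  by rewrite /= ltnS leq_mul2r le_nN orbT.
elim: d => [|d IHd] i {I0}s Ein Ii.
  rewrite addn0 in Ein; subst i.
  by exists 1, s; split=> //; apply: run_while_false; apply: stop.
have lt_in : i < n by lia.
have [e0 [t1 [s1 [r1 le1 I1]]]] := step i s lt_in Ii.
have [|t2 [s2 [r2 le2 I2]]] := IHd i.+1 s1 _ I1; first by lia.
exists (t1 + t2).+1, s2; split=> //; first exact: run_while_true r1 r2.
rewrite mulSn; lia.
Qed.

End TimedExecution.

(** Each loop multiplies the cost by about [N]. For two subprograms the exponents are added, which
    dominates both powers since [N] is positive. *)
Lemma cost_poly (p : cmd) :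
  exists c k, forall N, 0 < N -> cost N p <= c * N ^ k.
Proof.
elim: p => [|a e1 e2|p1 [c1 [k1 h1]] p2 [c2 [k2 h2]]
  |e p1 [c1 [k1 h1]] p2 [c2 [k2 h2]]|e p [c [k h]]].
- by exists 1, 0.
- by exists 1, 0.
- exists (c1 + c2), (k1 + k2) => N N0 /=; rewrite mulnDl.
  apply: leq_add; first apply: leq_trans (h1 N N0) _.
    by rewrite leq_mul2l leq_pexp2l ?leq_addr ?orbT.
  apply: leq_trans (h2 N N0) _.
  by rewrite leq_mul2l leq_pexp2l ?leq_addl ?orbT.
- exists (c1 + c2).+1, (k1 + k2) => N N0 /=.
  rewrite mulSn mulnDl -add1n; apply: leq_add; first by rewrite expn_gt0 N0.
  apply: leq_add; first apply: leq_trans (h1 N N0) _.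
    by rewrite leq_mul2l leq_pexp2l ?leq_addr ?orbT.
  apply: leq_trans (h2 N N0) _.
  by rewrite leq_mul2l leq_pexp2l ?leq_addl ?orbT.
(* The two extra units pay for the [N] successful tests and for the final failing one. *)
- exists c.+2, k.+1 => N N0 /=.
  have Nk : 0 < N ^ k by rewrite expn_gt0 N0.
  have := h N N0; rewrite expnS; nia.
Qed.

(* Scalar variables live in array 8. *)
Definition var (k : nat) : expr := Cell 8 (Lit k).
Definition set_var (k : nat) (e : expr) : cmd := Assign 8 (Lit k) e.

Definition for_loop (k : nat) (b : expr) (p : cmd) : cmd :=
  Seq (set_var k (Lit 0))
      (While (Minus b (var k)) (Seq p (set_var k (Plus (var k) (Lit 1))))).

(** The invariant must determine both the counter and the bound, because the loop re-evaluates [b]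
    in every round and the body could change either. *)
Lemma does_for N k b p n (I : nat -> memory -> Prop) (s : memory)
    (Q : memory -> Prop) :
  n <= N ->
  (forall i s, I i s -> eval s b = n /\ s 8 k = i) ->
  I 0 (update s 8 k 0) ->
  (forall i s, i < n -> I i s ->
     does N p s (fun s' => s' 8 k = i /\ I i.+1 (update s' 8 k i.+1))) ->
  (forall s, I n s -> Q s) ->
  does N (for_loop k b p) s Q.
Proof.
move=> le_nN bound I0 step post.
apply: does_seq; apply: does_assign.
suff [t [s' [r le Is]]] : does N (While (Minus b (var k))
    (Seq p (set_var k (Plus (var k) (Lit 1))))) (update s 8 k 0) (I n).
  by exists t, s'; split=> //; apply: post.
apply: does_while => // [i s1 lt_in Ii|s1 In]; last first.
  by have [/= -> ->] := bound _ _ In; rewrite subnn.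
have [/= -> ->] := bound _ _ Ii; split; first by rewrite subn_eq0 -ltnNge.
apply: does_seq; have [t [s2 [r le [E I2]]]] := step i s1 lt_in Ii.
exists t, s2; split=> //; apply: does_assign.
by rewrite /= E addn1.
Qed.

(** * Growing a spanning tree from vertex 0 *)

Definition upd (f : nat -> nat) (i x : nat) : nat -> nat :=
  fun j => if j == i then x else f j.

Definition visit (u v : expr) : cmd :=
  Seq (Assign 6 v u) (Seq (Assign 7 (var 0) v) (Seq (Assign 5 v (Lit 1))
    (set_var 0 (Plus (var 0) (Lit 1))))).

Definition scan_edge : cmd :=
  let u := Cell 2 (var 2) in let v := Cell 3 (var 2) in
  If (Cell 5 u) (If (Cell 5 v) Skip (visit u v))
                (If (Cell 5 v) (visit v u) Skip).

(* Spanning tree: array 5 marks the visited vertices, array 6 holds their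
   parents, array 7 lists them in order of discovery and variable 0 counts
   them. *)
Definition grow_tree : cmd :=
  Seq (Assign 5 (Lit 0) (Lit 1)) (Seq (set_var 0 (Lit 1))
    (for_loop 1 (Cell 0 (Lit 0)) (for_loop 2 (Cell 0 (Lit 1)) scan_edge))).

Section Tree.
Variables (n m : nat) (E1 E2 : nat -> nat) (R : rel nat).
Hypothesis n_gt0 : 0 < n.
Hypothesis E_lt : forall k, k < m -> E1 k < n /\ E2 k < n.
Hypothesis R_sym : symmetric R.
Hypothesis R_edge : forall k, k < m -> R (E1 k) (E2 k).
(** Connectivity as a closure principle: it applies directly to the set of visited vertices once no
    edge leaves that set. *)
Hypothesis E_connected : forall P : pred nat, P 0 ->
  (forall k, k < m -> P (E1 k) = P (E2 k)) -> forall v, v < n -> P v.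

(** Requiring parents to come earlier in [l] rules out cycles and makes [l] a valid order for both
    later passes: backwards for the loads, forwards for the labels. *)
Definition tree_order (par : nat -> nat) (l : seq nat) : Prop :=
  forall v, v \in l -> v != 0 -> R v (par v) /\ index (par v) l < index v l.

Record partial_tree (vis par ord : nat -> nat) (l : seq nat) : Prop := {
  pt_uniq : uniq l;
  pt_sub : {subset l <= iota 0 n};
  pt_root : 0 \in l;
  pt_vis : forall v, (vis v != 0) = (v \in l);
  pt_ord : forall i, i < size l -> ord i = nth 0 l i;
  pt_tree : tree_order par l }.

Lemma index_rcons_mem (x v : nat) (l : seq nat) :
  v \in l -> index v (rcons l x) = index v l.
Proof. by move=> vl; rewrite -cats1 index_cat vl. Qed.

Lemma partial_tree_rcons (vis par ord : nat -> nat) (l : seq nat) (u v : nat) :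
  partial_tree vis par ord l -> u \in l -> v \notin l -> v < n -> R v u ->
  partial_tree (upd vis v 1) (upd par v u) (upd ord (size l) v) (rcons l v).
Proof.
case=> Hu Hs Hr Hv Ho Ht ul vl vn Rvu; split.
- by rewrite rcons_uniq vl.
- move=> x; rewrite mem_rcons inE mem_iota => /predU1P[->//|/Hs].
  by rewrite mem_iota.
- by rewrite mem_rcons inE Hr orbT.
- by move=> x; rewrite mem_rcons inE /upd; case: (x == v).
- move=> i; rewrite size_rcons ltnS nth_rcons /upd leq_eqVlt.
  case/predU1P => [->|lt]; first by rewrite eqxx ltnn.
  by rewrite lt (ltn_eqF lt) Ho.
move=> x; rewrite mem_rcons inE /upd.
have [-> _ v0|_ /= xl x0] := eqVneq x v.
  split=> //; rewrite index_rcons_mem // -cats1 index_cat (negbTE vl) /= eqxx.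
  by rewrite addn0 index_mem.
have [Rx lt] := Ht x xl x0.
have pl : par x \in l by rewrite -index_mem (ltn_trans lt) ?index_mem.
by rewrite !index_rcons_mem.
Qed.

Definition graph_memory (q : nat) (s : memory) : Prop :=
  [/\ s 0 0 = n, s 0 1 = m, s 0 2 = q, s 2 = E1 & s 3 = E2].


(** The list [l] is a ghost copy of the discovery order. The zeros in cell 0 of array 4 and in
    variable 3 are initial values that the labelling pass relies on, so they are carried along. *)
Record tree_state (q : nat) (t : nat -> nat) (s : memory) (l : seq nat) :
    Prop := {
  ts_graph : graph_memory q s;
  ts_term : s 1 = t;
  ts_lab : s 4 0 = 0;
  ts_count : s 8 0 = size l;
  ts_absorbed : s 8 3 = 0;
  ts_tree : partial_tree (s 5) (s 6) (s 7) l }.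

Lemma tree_state_visit q t (s : memory) l (u v : nat) :
  tree_state q t s l ->
  u \in l -> v \notin l -> v < n -> R v u ->
  tree_state q t (update (update (update (update s 6 v u) 7 (s 8 0) v) 5 v 1)
                   8 0 (s 8 0 + 1)) (rcons l v).
Proof.
case=> Hg Ht Hl Hc Ha Hp ul vl vn Rvu; split=> //.
  by rewrite size_rcons -Hc -[(s 8 0).+1]addn1.
(* At a literal array number [update] is convertible to [upd] or to the old array. *)
by rewrite Hc; apply: partial_tree_rcons.
Qed.

(** The alternatives are the only ones that matter for progress: the tree grows, or the edge does
    not cross its boundary. *)
Lemma does_scan_edge N q t (s : memory) l :
  tree_state q t s l -> s 8 2 < m ->
  does N scan_edge s (fun s' => [/\ s' 8 1 = s 8 1, s' 8 2 = s 8 2 &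
    exists2 l', tree_state q t s' l' & size l < size l' \/
      l' = l /\ (E1 (s 8 2) \in l) = (E2 (s 8 2) \in l)]).
Proof.
move=> St jm; have [[_ _ _ e1 e2] _ _ _ _ Hp] := St.
have [lt1 lt2] := E_lt jm; have Redge := R_edge jm.
rewrite -{}e1 -{}e2 in lt1 lt2 Redge *.
set a := s 2 (s 8 2) in lt1 Redge *; set b := s 3 (s 8 2) in lt2 Redge *.
have keep : (a \in l) = (b \in l) -> does N Skip s (fun s' =>
    [/\ s' 8 1 = s 8 1, s' 8 2 = s 8 2 & exists2 l', tree_state q t s' l' &
      size l < size l' \/ l' = l /\ (a \in l) = (b \in l)]).
  by move=> Eab; apply: does_skip; split=> //; exists l => //; right.
apply: does_if => /= [/eqP/eqP|/eqP/negPn]; rewrite (pt_vis Hp) -/a => in1.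
  apply: does_if => /= [/eqP/eqP|/eqP/negPn]; rewrite (pt_vis Hp) -/b => in2.
    by apply: keep; rewrite in1 in2.
  do 3 (apply: does_seq; apply: does_assign); apply: does_assign; split=> //.
  exists (rcons l b); last by left; rewrite size_rcons.
  by apply: (tree_state_visit St in1 in2); rewrite // R_sym.
apply: does_if => /= [/eqP/eqP|/eqP/negPn]; rewrite (pt_vis Hp) -/b => in2.
  do 3 (apply: does_seq; apply: does_assign); apply: does_assign; split=> //.
  exists (rcons l a); last by left; rewrite size_rcons.
  exact: (tree_state_visit St in2 in1).
by apply: keep; rewrite (negbTE in1) (negbTE in2).
Qed.

Lemma does_grow_tree N q t (s : memory) :
  n <= N -> m <= N -> graph_memory q s -> s 1 = t ->
  (forall a i, 4 <= a -> s a i = 0) ->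
  does N grow_tree s (fun s' => exists l, tree_state q t s' l /\ size l = n).
Proof.
move=> nN mN Hg Ht H0; have [n0 m0 _ _ _] := Hg.
do 2 (apply: does_seq; apply: does_assign) => /=.
(* Every full scan of the edges adds a vertex unless the tree already spans, so [n] rounds
   suffice. *)
pose Outer i s := s 8 1 = i /\
  exists2 l, tree_state q t s l & minn n i.+1 <= size l.
apply: (does_for (n := n) (I := Outer)) => //.
- by move=> i s1 [Ei [l [[? _ _ _ _] _ _ _ _ _] _]].
- split=> //; exists [:: 0]; last by rewrite geq_minr.
  split=> //.
  + exact: H0.
  + by rewrite /update /= H0.
  split=> //.
  + by move=> x; rewrite inE mem_iota => /eqP->.
  + by move=> v; rewrite /update /= inE H0 //; case: (v == 0).
  + by case=> // _; rewrite /update /= H0.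
  + by move=> v; rewrite inE => /eqP->.
- move=> i s1 lt_in [Ei [l St le_l]].
  (* Either this round has already added a vertex, or none of the first [j] edges crosses the
     boundary of the current tree. *)
  pose Inner j s := [/\ s 8 1 = i, s 8 2 = j & exists2 l, tree_state q t s l &
    i.+1 < size l \/
    i.+1 <= size l /\ forall k, k < j -> (E1 k \in l) = (E2 k \in l)].
  apply: (does_for (n := m) (I := Inner)) => //.
  + by move=> j s2 [E1i Ej [l2 [[_ ? _ _ _] _ _ _ _ _] _]].
  + split=> //; exists l; first by case: St.
    by right; split=> //; apply: leq_trans le_l; rewrite leq_min lt_in /=.
  + move=> j s2 lt_jm [E1i Ej [l2 St2 H2]].
    have lt2 : s2 8 2 < m by rewrite Ej.
    have [t3 [s3 [r3 le3 [Ei3 Ej3 [l3 St3 H3]]]]] := does_scan_edge N St2 lt2.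
    exists t3, s3; split=> //; split; first by rewrite Ej3.
    split=> //; first by rewrite -E1i -Ei3.
    exists l3; first by case: St3.
    case: H3 => [lt|[-> Ecr]].
      by left; case: H2 => [|[]] *; lia.
    case: H2 => [|[le Hk]]; first by left.
    right; split=> // k; rewrite ltnS leq_eqVlt => /predU1P[->|/Hk//].
    by rewrite -Ej.
  move=> s2 [E1i _ [l2 St2 H2]]; split=> //; split=> //.
  exists l2; first by case: St2.
  case: H2 => [lt|[le Hk]]; first by rewrite (leq_trans (geq_minr _ _)).
  (* Nothing was added in this round, so [l2] is closed under all edges and contains 0; by
     connectivity it contains every vertex. *)
  rewrite (leq_trans (geq_minl _ _)) // -[n](size_iota 0).
  apply: uniq_leq_size; first exact: iota_uniq.
  move=> v; rewrite mem_iota => /andP[_ vn]; move: v vn.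
  by apply: E_connected => //; have [_ _ _ _ _ []] := St2.
move=> s1 [_ [l St le]]; exists l; split=> //.
have [_ _ _ _ _ Hp] := St; apply/eqP; rewrite eqn_leq.
rewrite (leq_trans _ le) ?andbT ?leq_min ?leqnn ?leqnSn //.
by rewrite -[n](size_iota 0) uniq_leq_size //; case: Hp.
Qed.

End Tree.

(* Bottom-up pass, in place in array 1: a vertex carrying fewer than q
   terminals passes them on to its parent. *)
Definition push_loads : cmd :=
  let v := Cell 7 (Minus (Minus (Cell 0 (Lit 0)) (Lit 1)) (var 1)) in
  for_loop 1 (Minus (Cell 0 (Lit 0)) (Lit 1))
    (If (Minus (Cell 0 (Lit 2)) (Cell 1 v))
        (Assign 1 (Cell 6 v) (Plus (Cell 1 (Cell 6 v)) (Cell 1 v))) Skip).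

(* Top-down pass: a vertex starts a new block if it carries at least q
   terminals.  If the root carries fewer than q, then the first such vertex
   joins the block of the root instead, and is recorded in variable 3. *)
Definition assign_labels : cmd :=
  let v := Cell 7 (Plus (var 1) (Lit 1)) in
  let inherit := Assign 4 v (Cell 4 (Cell 6 v)) in
  let own := Assign 4 v v in
  for_loop 1 (Minus (Cell 0 (Lit 0)) (Lit 1))
    (If (Minus (Cell 0 (Lit 2)) (Cell 1 v)) inherit
      (If (var 3) own
        (If (Minus (Cell 0 (Lit 2)) (Cell 1 (Lit 0)))
            (Seq inherit (set_var 3 v)) own))).

(** * Correctness of the load pass and of the labelling pass *)

Section Passes.
Variables (n q : nat) (R : rel nat) (par : nat -> nat) (l : seq nat).
Hypothesis n_gt0 : 0 < n.
Hypothesis l_uniq : uniq l.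
Hypothesis l_size : size l = n.
Hypothesis l_mem : forall v, (v \in l) = (v < n).
Hypothesis l_tree : tree_order R par l.

Lemma tree_parent v :
  v < n -> v != 0 -> [/\ R v (par v), par v < n & index (par v) l < index v l].
Proof.
rewrite -l_mem => vl v0; have [Rv lt] := l_tree vl v0; split=> //.
by rewrite -l_mem -index_mem (ltn_trans lt) ?index_mem.
Qed.

(** Any other first vertex would have a parent at a smaller position. *)
Lemma tree_root : nth 0 l 0 = 0.
Proof.
apply/eqP; apply: contraT => h0.
have hn : nth 0 l 0 < n by rewrite -l_mem mem_nth ?l_size.
by have [_ _] := tree_parent hn h0; rewrite index_uniq ?l_size.
Qed.

Lemma index_eq0 v : v < n -> (index v l == 0) = (v == 0).
Proof.
move=> vn; apply/eqP/eqP => [E|->].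
  by rewrite -(nth_index 0 (s := l) (x := v)) ?l_mem // E tree_root.
by rewrite -[in index _ _]tree_root index_uniq ?l_size.
Qed.

(** [P] is the set of vertices already processed. A light vertex keeps its value after handing it
    on, so the final array satisfies a recursion in [ld] itself and still shows which vertices are
    light. *)
Definition partial_loads (P : pred nat) (t ld : nat -> nat) : Prop :=
  forall v, v < n ->
    ld v = t v + \sum_(c < n | [&& P c, par c == v & ld c < q]) ld c.

Lemma partial_loads_step (P P' : pred nat) (t ld : nat -> nat) v :
  partial_loads P t ld -> v < n -> ~~ P v -> ~~ P (par v) -> par v != v ->
  (forall c, c < n -> P' c = P c || (c == v)) ->
  partial_loads P' t
    (if ld v < q then upd ld (par v) (ld (par v) + ld v) else ld).
Proof.
move=> Hld vn Pv Pu uv P'E x xn; set ld' := (X in X x).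
(* The only cell written is that of [par v], which is neither processed nor equal to [v], so no
   summand changes. *)
have Eld c : c < n -> P' c -> ld' c = ld c.
  move=> cn; rewrite P'E // /ld' /upd => Pc; case: ifP => // _.
  by have [Ec|//] := eqVneq c (par v); rewrite Ec (negbTE Pu) (negbTE uv) in Pc.
have -> : \sum_(c < n | [&& P' c, par c == x & ld' c < q]) ld' c =
    (if (par v == x) && (ld v < q) then ld v else 0) +
    \sum_(c < n | [&& P c, par c == x & ld c < q]) ld c.
  have -> : \sum_(c < n | [&& P' c, par c == x & ld' c < q]) ld' c =
      \sum_(c < n | [&& P' c, par c == x & ld c < q]) ld c.
    apply: eq_big => [c|c /andP[P'c _]]; last exact: Eld.
    by case P'c: (P' c) => //=; rewrite Eld.
  rewrite big_mkcond (bigD1 (Ordinal vn)) //= P'E // eqxx orbT /=.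
  congr (_ + _); rewrite [RHS]big_mkcond [RHS](bigD1 (Ordinal vn)) //=.
  rewrite (negbTE Pv) /= add0n; apply: eq_bigr => c cv.
  by rewrite P'E // -[c == v :> nat]/(c == Ordinal vn) (negbTE cv) orbF.
rewrite /ld' /upd [in RHS]addnCA -Hld //.
case: ifP => lt; last by rewrite andbF.
by rewrite andbT eq_sym; have [<-|] := eqVneq (par v) x; first exact: addnC.
Qed.

Definition loads : (nat -> nat) -> (nat -> nat) -> Prop :=
  partial_loads (fun c => c != 0).

(** [P] is the set of vertices already labelled, and [w] is the heavy vertex merged into the block
    of a light root, with 0 meaning none so far. The last clause says that until then only label 0
    has been given. *)
Definition partial_labels (P : pred nat) (ld : nat -> nat) (w : nat)
    (lab : nat -> nat) : Prop :=
  [/\ lab 0 = 0,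
      forall v, v < n -> P v -> v != 0 ->
        lab v = if (ld v < q) || (v == w) then lab (par v) else v,
      w != 0 -> [/\ w < n, P w, q <= ld w, ld 0 < q & lab w = 0]
    & w = 0 -> ld 0 < q -> forall v, v < n -> P v ->
        lab v = 0 /\ (v != 0 -> ld v < q)].

(** The three alternatives are the outcomes of the program's tests: [v] is light and inherits,
    starts a block, or is the heavy vertex absorbed by the root. *)
Lemma partial_labels_step (P P' : pred nat) (ld lab : nat -> nat) w v w' x :
  partial_labels P ld w lab -> v < n -> v != 0 -> ~~ P v -> P (par v) ->
  (forall u, u < n -> u != 0 -> P u -> P (par u)) ->
  par v < n ->
  (forall u, u < n -> P' u = P u || (u == v)) ->
  [\/ [/\ ld v < q, w' = w & x = lab (par v)],
      [/\ q <= ld v, (w != 0) || (q <= ld 0), w' = w & x = v]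
    | [/\ q <= ld v, w = 0, ld 0 < q, w' = v & x = lab (par v)]] ->
  partial_labels P' ld w' (upd lab v x).
Proof.
move=> [L0 Lv Lw L1] vn v0 Pv Ppv Pcl pvn P'E Hx.
have NP u : P u -> (u == v) = false by move=> Pu; apply: contraNF Pv => /eqP<-.
have upd_P u : P u -> upd lab v x u = lab u by move=> /NP E; rewrite /upd E.
have upd_v : upd lab v x v = x by rewrite /upd eqxx.
split.
- by rewrite /upd eq_sym (negbTE v0).
- move=> u un; rewrite P'E // => /orP[Pu|/eqP->] u0.
    rewrite !upd_P //; last exact: Pcl.
    rewrite (Lv _ un Pu u0).
    case: Hx => [[_ -> _]|[_ _ -> _]|[_ -> _ -> _]] //.
    by rewrite (NP u Pu) (negbTE u0).
  rewrite upd_v (upd_P _ Ppv).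
  case: Hx => [[-> _ ->]|[le Hw -> ->]|[_ _ _ -> ->]] //; last by rewrite eqxx orbT.
  (* Here [v] differs from [w], since [w] is already labelled and [v] is not. *)
  rewrite ltnNge le /=; case: eqP => // Evw.
  by have [_] := Lw ltac:(by rewrite -Evw); rewrite -Evw (negbTE Pv).
- case: Hx => [[_ -> _] w0|[_ _ -> _] w0|[le w0 lt0 -> Ex] _].
  + by have [wn Pw *] := Lw w0; split=> //; rewrite ?P'E ?Pw ?upd_P.
  + by have [wn Pw *] := Lw w0; split=> //; rewrite ?P'E ?Pw ?upd_P.
  (* No heavy vertex was met before, so the parent still has label 0 and [v] really joins the
     root. *)
  + split; rewrite ?P'E ?eqxx ?orbT // upd_v Ex.
    by have [] := L1 w0 lt0 _ pvn Ppv.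
case: Hx => [[lt -> Ex] w0 lt0|[_ Hw -> _] w0 lt0|[_ _ _ -> _] /eqP]; last first.
- by rewrite (negbTE v0).
- by move: Hw; rewrite w0 leqNgt lt0.
move=> u un; rewrite P'E // => /orP[Pu|/eqP->].
  by rewrite upd_P //; apply: L1.
by rewrite upd_v Ex; have [] := L1 w0 lt0 _ pvn Ppv.
Qed.

Definition labels : (nat -> nat) -> nat -> (nat -> nat) -> Prop :=
  partial_labels predT.

Record pass_memory (ld : nat -> nat) (w : nat) (lab : nat -> nat) (s : memory) :
    Prop := {
  pm_n : s 0 0 = n;
  pm_q : s 0 2 = q;
  pm_par : s 6 = par;
  pm_ord : forall i, i < n -> s 7 i = nth 0 l i;
  pm_load : s 1 = ld;
  pm_absorbed : s 8 3 = w;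
  pm_lab : s 4 = lab }.

Lemma does_push_loads N (t : nat -> nat) lab (s : memory) :
  n <= N -> pass_memory t 0 lab s ->
  does N push_loads s (fun s' => exists2 ld, loads t ld & pass_memory ld 0 lab s').
Proof.
move=> nN Hs.
(* After [i] rounds the last [i] vertices of [l] are processed. There are only [n.-1] rounds because
   the root has no parent to push to. *)
pose I i s := s 8 1 = i /\
  exists2 ld, partial_loads (fun c => n - i <= index c l) t ld &
    pass_memory ld 0 lab s.
apply: (does_for (n := n.-1) (I := I)); first by rewrite (leq_trans (leq_pred n)).
- by move=> i s1 [Ei [ld _ [/= -> *]]]; rewrite subn1.
- split=> //; exists t; last by case: Hs.
  move=> v vn; rewrite big1 ?addn0 // => c; rewrite subn0 leqNgt.
  by rewrite -[X in _ < X]l_size index_mem l_mem ltn_ord.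
- move=> i s1 lt_i [Ei [ld Hld H1]].
  have [n1 q1 p1 o1 ld1 w1 lab1] := H1.
  have lt_j : n - 1 - i < n by lia.
  pose v := nth 0 l (n - 1 - i).
  have Ev : s1 7 (s1 0 0 - 1 - s1 8 1) = v by rewrite n1 Ei o1.
  have vn : v < n by rewrite -l_mem mem_nth ?l_size.
  have iv : index v l = n - 1 - i by rewrite index_uniq ?l_size.
  have v0 : v != 0 by rewrite -index_eq0 // iv; lia.
  have [_ pn lt_p] := tree_parent vn v0.
  have Pstep : partial_loads (fun c => n - i.+1 <= index c l) t
      (if ld v < q then upd ld (par v) (ld (par v) + ld v) else ld).
    apply: (partial_loads_step Hld) => //; rewrite ?iv; try lia.
      by apply: contraTneq lt_p => ->; rewrite ltnn.
    move=> c cn; have -> : (c == v) = (index c l == index v l).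
      by rewrite -(inj_in_eq (@index_inj _ 0 l)) ?l_mem.
    rewrite iv; lia.
  apply: does_if => /=; rewrite q1 ld1 Ev => Hq.
    apply: does_assign; rewrite /= p1 ld1 Ev; split=> //; split=> //.
    exists (upd ld (par v) (ld (par v) + ld v)).
      by move: Pstep; rewrite ifT //; lia.
    by split=> //; rewrite /upd -ld1.
  apply: does_skip; split=> //; split=> //; exists ld => //.
  by move: Pstep; rewrite ifF //; lia.
move=> s1 [_ [ld Hld H1]]; exists ld => // v vn; rewrite (Hld v vn); congr (_ + _).
apply: eq_bigl => c; congr (_ && _).
by rewrite -index_eq0 // -lt0n; congr (_ <= _); lia.
Qed.

Lemma does_assign_labels N (ld lab0 : nat -> nat) (s : memory) :
  n <= N -> lab0 0 = 0 -> pass_memory ld 0 lab0 s ->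
  does N assign_labels s
    (fun s' => exists w lab, labels ld w lab /\ pass_memory ld w lab s').
Proof.
move=> nN lab00 Hs.
(* After [i] rounds the first [i.+1] vertices are labelled: the root has its label 0 from the
   start. *)
pose I i s := s 8 1 = i /\ exists w lab,
  partial_labels (fun c => index c l <= i) ld w lab /\ pass_memory ld w lab s.
apply: (does_for (n := n.-1) (I := I)); first by rewrite (leq_trans (leq_pred n)).
- by move=> i s1 [Ei [w [lab [_ [/= -> *]]]]]; rewrite subn1.
- split=> //; exists 0, lab0; split; last by case: Hs.
  split=> // [v vn|_ _ v vn]; rewrite leqn0 index_eq0 //.
    by move=> ->.
  by move=> /eqP->.
- move=> i s1 lt_i [Ei [w [lab [Hlab H1]]]].
  have [n1 q1 p1 o1 ld1 w1 lab1] := H1.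
  have lt_j : i.+1 < n by lia.
  pose v := nth 0 l i.+1.
  have Ev : s1 7 (s1 8 1 + 1) = v by rewrite Ei addn1 o1.
  have vn : v < n by rewrite -l_mem mem_nth ?l_size.
  have iv : index v l = i.+1 by rewrite index_uniq ?l_size.
  have v0 : v != 0 by rewrite -index_eq0 // iv.
  have [_ pn lt_p] := tree_parent vn v0.
  have Pstep w' x :
      [\/ [/\ ld v < q, w' = w & x = lab (par v)],
          [/\ q <= ld v, (w != 0) || (q <= ld 0), w' = w & x = v]
        | [/\ q <= ld v, w = 0, ld 0 < q, w' = v & x = lab (par v)]] ->
      partial_labels (fun c => index c l <= i.+1) ld w' (upd lab v x).
    apply: (partial_labels_step Hlab) => //; rewrite ?iv ?ltnn //.
    - by rewrite -ltnS -iv.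
    - by move=> u un u0; apply: leq_trans; have [_ _ /ltnW] := tree_parent un u0.
    move=> c cn; have -> : (c == v) = (index c l == index v l).
      by rewrite -(inj_in_eq (@index_inj _ 0 l)) ?l_mem.
    rewrite iv; lia.
  have own : q <= ld v -> (w != 0) || (q <= ld 0) ->
      partial_labels (fun c => index c l <= i.+1) ld w (upd lab v v).
    by move=> *; apply: Pstep; constructor 2.
  apply: does_if => /=; rewrite q1 ld1 Ev => Hq.
    apply: does_assign; rewrite /= p1 lab1 Ev; split=> //; split=> //.
    exists w, (upd lab v (lab (par v))); split; last by split=> //; rewrite /upd -lab1.
    by apply: Pstep; constructor 1; split=> //; lia.
  apply: does_if => /=; rewrite w1 => Hw.
    apply: does_assign; rewrite /= Ev; split=> //; split=> //.
    exists w, (upd lab v v); split; last by split=> //; rewrite /upd -lab1.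
    by apply: own; [lia | rewrite Hw].
  apply: does_if => /=; rewrite q1 ld1 => Hq0.
    apply: does_seq; apply: does_assign; apply: does_assign.
    rewrite /= p1 lab1 Ev; split=> //; split=> //.
    exists v, (upd lab v (lab (par v))); split; last first.
      by split=> //; rewrite /upd -lab1.
    by apply: Pstep; constructor 3; split=> //; lia.
  apply: does_assign; rewrite /= Ev; split=> //; split=> //.
  exists w, (upd lab v v); split; last by split=> //; rewrite /upd -lab1.
  by apply: own; lia.
move=> s1 [_ [w [lab [[L0 Lv Lw L1] H1]]]]; exists w, lab; split=> //.
have P v : v < n -> index v l <= n.-1.
  by rewrite -l_mem -index_mem l_size; lia.
by split=> // [v vn _|w0|w0 lt0 v vn _]; [apply/Lv/P | have [] := Lw w0 | apply/L1/P].
Qed.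

End Passes.

(** * Counting the terminals of a block *)

Section Blocks.
Variables (n q : nat) (R : rel nat) (par : nat -> nat) (l : seq nat).
Variables (t ld lab : nat -> nat) (w : nat).
Hypothesis n_gt0 : 0 < n.
Hypothesis l_mem : forall v, (v \in l) = (v < n).
Hypothesis l_tree : tree_order R par l.
Hypothesis ldP : loads n q par t ld.
Hypothesis labP : labels n q par ld w lab.

Lemma index_ind (P : nat -> Prop) :
  P 0 -> (forall v, v < n -> v != 0 -> P (par v) -> P v) ->
  forall v, v < n -> P v.
Proof.
move=> P0 IH v; have [k] := ubnP (index v l).
elim: k v => // k IHk v lt_k vn; have [->//|v0] := eqVneq v 0.
have [_ pn lt_p] := tree_parent l_mem l_tree vn v0.
by apply: IH => //; apply: IHk => //; apply: leq_trans lt_p _.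
Qed.

(** Climbing along inherited labels ends at the root or at a heavy vertex that names its own
    block. *)
Lemma label_cases v : v < n ->
  lab v = 0 \/
  [/\ lab v < n, lab v != 0, q <= ld (lab v), lab v != w
    & lab (lab v) = lab v].
Proof.
have [L0 Lv _ _] := labP; move: v; apply: index_ind => [|v vn v0]; first by left.
have := Lv v vn isT v0; case: ifP => [_ <-//|/norP[]].
by rewrite -leqNgt => le vw E _; right; rewrite !E; split.
Qed.

(* Summing the recursion for the loads over a block, the load of each light
   vertex cancels against its contribution to its parent, which lies in the
   same block. *)
Lemma block_terminals r :
  \sum_(v < n | lab v == r) t v =
  \sum_(v < n | (lab v == r) && ((v == 0 :> nat) || (q <= ld v))) ld v.
Proof.
have [L0 Lv _ _] := labP.
set S := RHS; pose L :=
  \sum_(c < n | (lab c == r) && ~~ ((c == 0 :> nat) || (q <= ld c))) ld c.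
(* Adding the light load [L] to both sides avoids subtraction: the right side becomes the whole load
   of the block, and after unfolding the recursion [L] has to match the contributions received from
   children. *)
apply/eqP; rewrite -(eqn_add2r L) /S -bigID /= eq_sym; apply/eqP.
rewrite (eq_bigr _ (fun v _ => ldP (ltn_ord v))) big_split; congr (_ + _).
rewrite (exchange_big_dep (fun c : 'I_n => (c != 0 :> nat) && (ld c < q))) /=; last first.
  by move=> v c _ /and3P[-> _].
rewrite /L [LHS]big_mkcond [RHS]big_mkcond; apply: eq_bigr => c _.
rewrite negb_or -ltnNge.
have [//|c0] := eqVneq (nat_of_ord c) 0; first by rewrite andbF.
case: ltnP => [lt|le] /=; last by rewrite andbF.
have [_ pn _] := tree_parent l_mem l_tree (ltn_ord c) c0.
rewrite andbT (Lv c (ltn_ord c) isT c0) lt /= (eq_bigl (fun v : 'I_n =>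
  (lab (par c) == r) && (v == Ordinal pn))); last first.
  move=> v; rewrite andbT -[v == Ordinal pn]/(v == par c :> nat).
  by rewrite [par c == v]eq_sym; have [->|_] := eqVneq (v : nat) (par c); rewrite ?andbF.
case: ifP => _; last by rewrite big1.
by rewrite big_pred1_eq.
Qed.

Hypothesis q_gt0 : 0 < q.
Hypothesis t_le1 : forall v, t v <= 1.
(** The summand [v != 0] accounts for the parent among the at most four neighbours. *)
Hypothesis children : forall v, v < n ->
  #|[pred c : 'I_n | (c != 0 :> nat) && (par c == v)]| + (v != 0) <= 4.
Hypothesis t_total : q <= \sum_(v < n) t v.

Lemma load_le v : v < n -> ld v <= (if v == 0 then 4 else 3) * q.-1 + 1.
Proof.
move=> vn; rewrite ldP // addnC leq_add //.
apply: leq_trans (_ : \sum_(c < n | (c != 0 :> nat) && (par c == v)) q.-1 <= _).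
  rewrite [leqRHS]big_mkcond [leqLHS]big_mkcond; apply: leq_sum => c _.
  by case: (_ != 0) => //=; case: eqP => //= _; case: ltnP => // lt; lia.
rewrite sum_nat_const leq_mul2r; apply/orP; right.
have le4 := children vn; apply: leq_trans (_ : 4 - (v != 0) <= _).
  by rewrite leq_subRL 1?addnC //; case: (v == 0).
by case: (v == 0).
Qed.

Lemma block_terminals_bounds x : x < n ->
  q <= \sum_(v < n | lab v == lab x) t v <= 4 * q.
Proof.
move=> xn; have [L0 Lv Lw L1] := labP; rewrite block_terminals.
have heavyE v : v < n -> v != 0 -> q <= ld v -> v != w -> lab v = v.
  by move=> vn v0 le vw; rewrite (Lv v vn isT v0) ltnNge le (negbTE vw).
have ld0 := load_le n_gt0; rewrite eqxx in ld0.
have [E|[rn r0 le rw Er]] := label_cases xn; last first.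
  (* In a block with nonzero label the sum reduces to its top vertex: the root and [w] have label 0,
     and any other heavy vertex names its own block. *)
  rewrite (big_pred1 (Ordinal rn)) /=.
    by have := load_le rn; rewrite (negbTE r0) le; lia.
  move=> v; rewrite /= -[v == _]/(v == lab x :> nat).
  apply/andP/eqP => [[/eqP Ev /orP[/eqP v0|lev]]|->]; last by rewrite Er le orbT.
    by move: r0; rewrite -Ev v0 L0.
  have v0 : v != 0 :> nat by apply: contraNneq r0 => v0; rewrite -Ev v0 L0.
  rewrite -Ev heavyE //; apply: contraNneq r0 => vw; rewrite -Ev vw.
  have w0 : w != 0 by rewrite -vw.
  by have [_ _ _ _ ->] := Lw w0.
rewrite E; have [w0|w0] := eqVneq w 0.
  have H : \sum_(v < n | (lab v == 0) && ((v == 0 :> nat) || (q <= ld v))) ld v = ld 0.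
    rewrite (big_pred1 (Ordinal n_gt0)) //= => v.
    rewrite /= -[v == _]/(v == 0 :> nat).
    apply/andP/eqP => [[/eqP Ev /predU1P[//|le]]|->]; last by rewrite L0.
    apply/eqP; apply: contraT => v0; have [lt0|le0] := ltnP (ld 0) q.
      by have [_ /(_ v0)] := L1 w0 lt0 v (ltn_ord v) isT; rewrite ltnNge le.
    have Evv : lab v = v by apply: heavyE; rewrite ?w0.
    by rewrite -Evv Ev in v0.
  have [lt0|le0] := ltnP (ld 0) q; last by rewrite H le0; lia.
  (* The root is light and absorbed nothing, so all vertices share label 0 and the lower bound is
     the total number of terminals. *)
  rewrite -[X in q <= X]block_terminals (eq_bigl xpredT) ?t_total ?H; last first.
    by move=> v; have [-> _] := L1 w0 lt0 v (ltn_ord v) isT; rewrite eqxx.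
  by rewrite /=; lia.
(* The root's block with an absorbed vertex: [ld w] alone gives the lower bound. *)
have [wn _ lew lt0 labw] := Lw w0.
have -> : \sum_(v < n | (lab v == 0) && ((v == 0 :> nat) || (q <= ld v))) ld v =
    ld 0 + ld w.
  rewrite (bigD1 (Ordinal n_gt0)) /= ?L0 //; congr (_ + _).
  rewrite (big_pred1 (Ordinal wn)) //= => v.
  rewrite /= -[v == Ordinal n_gt0]/(v == 0 :> nat) -[v == _]/(v == w :> nat).
  apply/andP/eqP => [[/andP[/eqP Ev le] v0]|->]; last by rewrite labw w0 lew orbT.
  rewrite (negbTE v0) /= in le; apply/eqP; apply: contraT => vw.
  have Evv : lab v = v by apply: heavyE.
  by rewrite -Evv Ev in v0.
by have := load_le wn; rewrite (negbTE w0); lia.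
Qed.

End Blocks.

(** * The complete program *)

Definition partition_program : cmd :=
  Seq grow_tree (Seq push_loads assign_labels).

Lemma does_partition_program N (n m q : nat) (E1 E2 : nat -> nat) (R : rel nat)
    (t : nat -> nat) (s : memory) :
  0 < n -> (forall k, k < m -> E1 k < n /\ E2 k < n) -> symmetric R ->
  (forall k, k < m -> R (E1 k) (E2 k)) ->
  (forall P : pred nat, P 0 -> (forall k, k < m -> P (E1 k) = P (E2 k)) ->
     forall v, v < n -> P v) ->
  n <= N -> m <= N -> graph_memory n m E1 E2 q s -> s 1 = t ->
  (forall a i, 4 <= a -> s a i = 0) ->
  does N partition_program s (fun s' => exists par l ld w,
    [/\ forall v, (v \in l) = (v < n), tree_order R par l,
        loads n q par t ld & labels n q par ld w (s' 4)]).
Proof.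
move=> n0 E_lt Rsym Redge conn nN mN Hg Ht H0; apply: does_seq.
have [t1 [s1 [r1 le1 [l [St1 size_l]]]]] :=
  does_grow_tree n0 E_lt Rsym Redge conn nN mN Hg Ht H0.
exists t1, s1; split=> //; apply: does_seq.
have [[n1 m1 q1 _ _] Et Elab _ Ew Hp] := St1.
have [l_uniq l_sub _ _ ordP treeP] := Hp.
have l_mem v : (v \in l) = (v < n).
  have [_ ->] := uniq_min_size l_uniq l_sub ltac:(by rewrite size_iota size_l).
  by rewrite mem_iota.
have pm1 : pass_memory n q (s1 6) l t 0 (s1 4) s1.
  by split=> // i; rewrite -size_l; apply: ordP.
have [t2 [s2 [r2 le2 [ld ldP pm2]]]] :=
  does_push_loads n0 l_uniq size_l l_mem treeP nN pm1.
exists t2, s2; split=> //.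
have [t3 [s3 [r3 le3 [w [lab [labP pm3]]]]]] :=
  does_assign_labels n0 l_uniq size_l l_mem treeP nN Elab pm2.
exists t3, s3; split=> //; exists (s1 6), l, ld, w; split=> //.
by case: pm3 => _ _ _ _ _ _ ->.
Qed.

(** * Degrees and connected blocks in the graph *)

Section GraphFacts.
Variable G : graph.

Lemma adj_sym : symmetric (@adj G).
Proof. by move=> u v; rewrite /adj orbC. Qed.

(** Every neighbour is the other end of an incident entry of the edge list; parallel edges only
    increase the degree. *)
Lemma card_adj_le_degree (v : vertex G) : #|[pred u | adj u v]| <= degree v.
Proof.
pose other (e : vertex G * vertex G) := if e.1 == v then e.2 else e.1.
rewrite /degree -size_filter -(size_map other); apply: leq_trans (card_size _).
apply: subset_leq_card; apply/subsetP => u; rewrite !inE /adj => /orP[] uv.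
  apply/mapP; exists (u, v); first by rewrite mem_filter /= eqxx orbT.
  by rewrite /other /=; case: eqP.
apply/mapP; exists (v, u); first by rewrite mem_filter /= eqxx.
by rewrite /other /= eqxx.
Qed.

Lemma connected_closed (P : pred (vertex G)) (r : vertex G) :
  graph_connected G -> P r ->
  (forall e, e \in edges G -> P e.1 = P e.2) -> forall v, P v.
Proof.
case=> _ conn Pr inv v.
have := conn r v (in_setT _) (in_setT _).
suff cl : closed
    [rel x y | [&& x \in [set: vertex G], y \in [set: vertex G] & adj x y]] P.
  by move=> /(closed_connect cl); rewrite -!topredE /= Pr.
move=> x y /= /and3P[_ _ /orP[] /inv /=]; rewrite -!topredE //=.
Qed.

Variables (R : rel nat) (par : nat -> nat) (l : seq nat).
Hypothesis R_adj : forall u v : vertex G, R u v = adj u v.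
Hypothesis l_mem : forall v, (v \in l) = (v < nv G).
Hypothesis l_tree : tree_order R par l.

(** Children are neighbours, and the parent is one more: were it also a child, it would come both
    before and after [v] in [l]. *)
Lemma card_children (v : vertex G) :
  #|[pred c : vertex G | (c != 0 :> nat) && (par c == v)]| + (v != 0 :> nat)
  <= degree v.
Proof.
apply: leq_trans (card_adj_le_degree v).
have sub : [pred c : vertex G | (c != 0 :> nat) && (par c == v)]
    \subset [pred u | adj u v].
  apply/subsetP => c; rewrite !inE => /andP[c0 /eqP Ec].
  by rewrite -R_adj -Ec; have [] := tree_parent l_mem l_tree (ltn_ord c) c0.
have [v0|v0] := eqVneq (v : nat) 0; first by rewrite addn0 subset_leq_card.
have [Rv pn lt_p] := tree_parent l_mem l_tree (ltn_ord v) v0.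
rewrite addn1; apply: proper_card; apply/properP; split=> //.
exists (Ordinal pn); first by rewrite inE adj_sym -R_adj.
rewrite inE /=; apply/negP => /andP[p0 /eqP Ep].
have [_ _] := tree_parent l_mem l_tree pn p0.
by rewrite Ep ltnNge ltnW.
Qed.

(** A vertex that inherits its label is adjacent to its parent in the same block, so every vertex
    can climb inside the block to the vertex whose number is the label. *)
Lemma block_connected n q (ld lab : nat -> nat) w (x : vertex G) :
  n = nv G -> labels n q par ld w lab ->
  induces_connected [set v : vertex G | lab v == lab x].
Proof.
move=> -> [L0 Lv _ _]; set B := [set v | _].
pose e := [rel u v | [&& u \in B, v \in B & adj u v]].
split; first by apply/set0Pn; exists x; rewrite inE.
have e_sym : connect_sym e.
  by apply: sym_connect_sym => u v; rewrite /= adj_sym andbCA.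
(* The bound is quantified again inside the claim so that induction on numbers can speak of the
   ordinal built from it. *)
suff main v : v < nv G -> forall vn : v < nv G, lab v = lab x ->
    exists2 y : vertex G, y = lab x :> nat & connect e (Ordinal vn) y.
  have B_root u : u \in B ->
      exists2 y : vertex G, y = lab x :> nat & connect e u y.
    rewrite inE => /eqP Eu; have [y Ey uy] := main u (ltn_ord u) (ltn_ord u) Eu.
    by exists y => //; congr (connect e _ y): uy; apply: val_inj.
  move=> u v /B_root[y Ey uy] /B_root[z Ez vz].
  by rewrite (connect_trans uy) // (val_inj (etrans Ey (esym Ez))) e_sym.
move: v; apply: (index_ind l_mem l_tree) => [vn|v vn v0 IH vn'] Ev.
  by exists (Ordinal vn); rewrite // -Ev L0.
have := Lv v vn isT v0; case: ifP => _ Elab; last first.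
  by exists (Ordinal vn'); rewrite // -Ev Elab.
have [Rv pn _] := tree_parent l_mem l_tree vn v0.
have Ep : lab (par v) = lab x by rewrite -Elab.
have [y Ey py] := IH pn Ep; exists y => //.
apply: connect_trans (connect1 _) py.
by rewrite /= !inE /= Ev Ep eqxx -R_adj.
Qed.

End GraphFacts.

(** * Transfer between the encoded input and the graph *)

Theorem theorem14 (R : realType) :
  exists (p : cmd) (c k : nat),
    forall (G : graph) (T : {set vertex G}) (alpha : R) (q : nat),
      graph_connected G ->
      max_degree_le G 4 ->
      (0 < alpha)%R -> (alpha < 1)%R ->
      well_linked alpha T ->
      smallest_even_ge (4%:R / alpha)%R q ->
      q <= #|T| ->
      exists (t : nat) (s : memory) (C : {set {set vertex G}}),
        [/\ run p (load (encode T q)) t s,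
            t <= c * input_size (encode T q) ^ k,
            outputs_partition s C
          & forall A : {set vertex G}, A \in C ->
              q <= #|A :&: T| <= 4 * q /\ induces_connected A].
Proof.
have [c [k cost_le]] := cost_poly partition_program.
exists partition_program, c, k => G T alpha q conn deg a0 _ _ [_ q_ge _] q_le.
have q0 : 0 < q.
  rewrite -(ltr0n R); apply: lt_le_trans q_ge.
  by rewrite mulr_gt0 ?ltr0n ?invr_gt0.
pose n := nv G; pose m := size (edges G).
pose E1 := nth 0 [seq val e.1 | e <- edges G].
pose E2 := nth 0 [seq val e.2 | e <- edges G].
pose ter := nth 0 [seq nat_of_bool (v \in T) | v <- enum 'I_(nv G)].
(* Adjacency is transported to plain numbers, which is what the arrays hold. *)
pose adjn : rel nat := fun a b => [exists u : vertex G, exists v : vertex G,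
  [&& val u == a, val v == b & adj u v]].
have n0 : 0 < n by case: conn => /set0Pn[x _] _; apply: leq_ltn_trans (ltn_ord x).
have EE i : i < m -> exists2 e, e \in edges G & E1 i = e.1 /\ E2 i = e.2.
  move=> im; exists (nth (Ordinal n0, Ordinal n0) (edges G) i); first exact: mem_nth.
  by rewrite /E1 /E2 !(nth_map (Ordinal n0, Ordinal n0)).
have E_lt i : i < m -> E1 i < n /\ E2 i < n.
  by case/EE => e _ [-> ->]; rewrite !ltn_ord.
have adjnP (u v : vertex G) : adjn u v = adj u v.
  apply/existsP/idP => [[u' /existsP[v' /and3P[/eqP/val_inj-> /eqP/val_inj->]]]//|uv].
  by exists u; apply/existsP; exists v; rewrite !eqxx.
have adjn_sym : symmetric adjn.
  suff H a b : adjn a b -> adjn b a by move=> a b; apply/idP/idP; apply: H.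
  case/existsP=> u /existsP[v /and3P[ua vb uv]].
  by apply/existsP; exists v; apply/existsP; exists u; rewrite ua vb adj_sym.
have adjn_edge i : i < m -> adjn (E1 i) (E2 i).
  by case/EE => -[u v] uv [-> ->]; rewrite adjnP /adj uv.
have connP (P : pred nat) : P 0 -> (forall i, i < m -> P (E1 i) = P (E2 i)) ->
    forall v, v < n -> P v.
  move=> P0 inv v vn; rewrite -[v]/(val (Ordinal vn)).
  apply: (connected_closed (P := P \o val) (r := Ordinal n0)) => // e.
  move/(nthP e) => [i im <-]; have := inv i im.
  by rewrite /E1 /E2 !(nth_map e).
have sizeE : input_size (encode T q) = 3 + n + m + m.
  by rewrite /input_size /= !size_map -enumT size_enum_ord -/n -/m; lia.
have terE (v : vertex G) : ter v = (v \in T).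
  by rewrite /ter (nth_map v) ?size_enum_ord // nth_ord_enum.
have ter_le1 v : ter v <= 1.
  have [vn|nv] := ltnP v n; first by rewrite (terE (Ordinal vn)) leq_b1.
  by rewrite /ter nth_default // size_map size_enum_ord.
have terS (A : {set vertex G}) : \sum_(v < n | v \in A) ter v = #|A :&: T|.
  rewrite -sum1_card big_mkcond [RHS]big_mkcond; apply: eq_bigr => v _.
  by rewrite terE inE; case: (v \in A) => //; case: (v \in T).
(* The input size serves as [N]: it is positive and bounds both [n] and [m], hence the rounds of
   every loop. *)
have le_cost := cost_le (input_size (encode T q)) ltac:(by rewrite sizeE).
have nN : n <= input_size (encode T q) by rewrite sizeE; lia.
have mN : m <= input_size (encode T q) by rewrite sizeE; lia.
have mem_graph : graph_memory n m E1 E2 q (load (encode T q)) by split.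
have mem_zero a i : 4 <= a -> load (encode T q) a i = 0.
  by case: a => [|[|[|[|a]]]] // _; rewrite /load /= !nth_nil.
have [t [s [r le_t [par [l [ld [w [l_mem treeP ldP labP]]]]]]]] :=
  does_partition_program n0 E_lt adjn_sym adjn_edge connP nN mN mem_graph
    (erefl ter) mem_zero.
exists t, s, (preim_partition (fun v : vertex G => s 4 v) [set: vertex G]).
have lab_rel : {in [set: vertex G] & &,
    equivalence_rel (fun u v : vertex G => s 4 u == s 4 v)}.
  by split=> [|/eqP->].
split=> //; first exact: leq_trans le_t le_cost.
  split; first exact: preim_partitionP.
  by move=> u v; rewrite pblock_equivalence_partition ?inE.
move=> A /imsetP[x _ ->].
set B := [set y in _ | _].
have BE v : (v \in B) = (s 4 v == s 4 x) by rewrite !inE eq_sym.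
have children v : v < n ->
    #|[pred c : 'I_n | (c != 0 :> nat) && (par c == v)]| + (v != 0) <= 4.
  by move=> vn; apply: leq_trans (deg (Ordinal vn));
    apply: (card_children adjnP l_mem treeP (Ordinal vn)).
split.
  rewrite -terS (eq_bigl _ _ BE).
  apply: (block_terminals_bounds n0 l_mem treeP ldP labP) => //.
  have -> : \sum_(v < n) ter v = #|T|; last by [].
  by rewrite -[T]setTI -terS; apply: eq_bigl => v; rewrite inE.
have -> : B = [set v : vertex G | s 4 v == s 4 x].
  by apply/setP => v; rewrite BE inE.
exact: (block_connected adjnP l_mem treeP x (erefl n) labP).
Qed.
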